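(* Let the training data distribution $P_x$ fulfill $\mathbb E_{x\sim P_x}[\|x\|^2]<+\infty$. Then $$\lim_{\delta\to0}\ \mathbb E_{x\sim P_x}\ \sup_{\|\varepsilon\|<\delta}\ \big\|R^{adv_2}_\delta(Ax+\varepsilon)-A^\dagger Ax\big\|=0 .$$
   Context: $X,Y$ are real Hilbert spaces and $A:X\to Y$ is a compact linear operator with infinite-dimensional range and singular value expansion $Ax=\sum_{n\in\mathbb N}\sigma_n\langle x,u_n\rangle v_n$, where $\sigma_n>0$, $(u_n)$ is an orthonormal basis of $\mathcal N(A)^\perp$ and $(v_n)$ an orthonormal basis of $\overline{\mathcal R(A)}$. $A^\dagger$ is the pseudo-inverse, so $A^\dagger A$ is the orthogonal projection onto $\mathcal N(A)^\perp$. $P_x$ is a Borel probability distribution on $X$. For a real sequence $g=(g_n)$, $R[g](y)=\sum_n g_n\langle y,v_n\rangle u_n$; norms of divergent series are $+\infty$. For $\delta>0$, $R^{adv_2}_\delta=R[g^{adv_2}]$, where $g^{adv_2}=g^{adv_2}(\delta)$ is a minimizer over real sequences $g$ of the adversarial training objective $$g\mapsto\mathbb E_{x\sim P_x}\ \sup_{\varepsilon\in Y,\ \|\varepsilon\|\le\delta}\|R[g](Ax+\varepsilon)-x\|^2$$ (minimizers exist). The suprema are over $\varepsilon\in Y$. *)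

(* Defs.v *)
From HB Require Import structures.
From mathcomp Require Import all_boot all_order all_algebra.
From mathcomp Require Import all_classical all_reals all_analysis.

Set Implicit Arguments.
Unset Strict Implicit.
Unset Printing Implicit Defensive.

Import Order.TTheory GRing.Theory Num.Theory.
Import numFieldNormedType.Exports.

Local Open Scope classical_set_scope.
Local Open Scope ring_scope.

(** Real Hilbert spaces: complete normed modules whose norm comes from a
    positive definite symmetric bilinear form. *)
HB.mixin Record CompleteNormedModule_isHilbert (R : realType) V
    & CompleteNormedModule R V := {
  inner : {dot V for idfun};
  inner_normE : forall x : V, inner x x = `|x| ^+ 2
}.

#[short(type="hilbertType")]
HB.structure Definition Hilbert (R : realType) :=
  {V of CompleteNormedModule R V & CompleteNormedModule_isHilbert R V}.

Section Geometry.
Context {R : realType} {V : hilbertType R}.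
Implicit Types (S E : set V) (e : nat -> V).

Definition orthocompl S : set V := [set x | forall s, S s -> inner x s = 0].

Definition lspan E : set V :=
  [set x | exists (n : nat) (c : 'I_n -> R) (b : 'I_n -> V),
     (forall i, E (b i)) /\ x = \sum_i c i *: b i].

Definition infinite_dimensional S :=
  forall B : set V, finite_set B -> ~ (S `<=` lspan B).

Definition orthonormal_seq e := forall m n, inner (e m) (e n) = (m == n)%:R.

Definition orthonormal_basis S e :=
  orthonormal_seq e /\ S = closure (lspan (range e)).

End Geometry.

Section Operators.
Context {R : realType} {X Y : hilbertType R}.
Implicit Types (A : {linear X -> Y}) (sigma g : nat -> R).
Implicit Types (u : nat -> X) (v : nat -> Y).

Definition null_space A : set X := [set x | A x = 0].

Definition compact_operator A :=
  forall B : set X, bounded_set B -> precompact (A @` B).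

Definition singular_value_expansion A sigma u v :=
  [/\ forall n, 0 < sigma n,
      orthonormal_basis (orthocompl (null_space A)) u,
      orthonormal_basis (closure (range A)) v &
      forall x, series (fun n => (sigma n * inner x (u n)) *: v n) @ \oo --> A x].

(** Moore-Penrose inverse: the linear extension of the inverse of
    A : N(A)^_|_ -> R(A) by 0 on R(A)^_|_. It is set to 0 outside its natural
    domain R(A) + R(A)^_|_. *)
Definition pseudo_inverse A (y : Y) : X :=
  xget 0 [set x | orthocompl (null_space A) x /\ orthocompl (range A) (y - A x)].

Definition recon_series g u v (y : Y) : nat -> X :=
  series (fun n => (g n * inner y (v n)) *: u n).

(** || R[g](y) - z ||, equal to +oo when the series R[g](y) diverges. *)
Definition recon_error g u v (y : Y) (z : X) : \bar R :=
  if `[< cvgn (recon_series g u v y) >]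
  then `|limn (recon_series g u v y) - z|%:E else +oo%E.

(** The supremum over the noise is lower semicontinuous in x (a supremum of
    norms of partial sums), hence the integrand is Borel measurable. *)
Definition adv2_objective (P : probability (g_sigma_algebraType (@open X)) R)
    A u v (delta : R) g : \bar R :=
  (\int[P]_x ereal_sup [set recon_error g u v (A x + eps)%R x ^+ 2 |
                          eps in [set eps : Y | (`|eps| <= delta)%R]])%E.

Definition adv2_minimizer (P : probability (g_sigma_algebraType (@open X)) R)
    A u v (delta : R) g :=
  forall h : nat -> R,
    (adv2_objective P A u v delta g <= adv2_objective P A u v delta h)%E.

End Operators.

(* Main.v *)
Require Import Defs.
From HB Require Import structures.
From mathcomp Require Import all_boot all_order all_algebra.
From mathcomp Require Import all_classical all_reals all_analysis.
From mathcomp Require Import measurable_realfun ring.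

Set Implicit Arguments.
Unset Strict Implicit.
Unset Printing Implicit Defensive.

Import Order.TTheory GRing.Theory Num.Theory.
Import numFieldNormedType.Exports.

Local Open Scope classical_set_scope.
Local Open Scope ring_scope.

(** Write [z = A^+ A x]. By Pythagoras the squared error to [x] is the squared
    error to [z] plus [|x - z|^2], so by AM-GM, for every [t > 0],
    [2 t E sup |R(Ax + eps) - z| + E |x - z|^2 <= t^2 + objective(g)].
    By minimality the objective is at most its value at the truncated inverse
    [g_n = 1 / sigma_n] for [n < N], [0] beyond. For that competitor the noise is
    orthogonal to the truncation error [x - P_N x], which bounds its objective by
    [E |x - P_N x|^2 + delta^2 \sum_(n < N) sigma_n^-2]. Dominated convergence
    gives [E |x - P_N x|^2 --> E |x - z|^2]; choose [N], then [delta], small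
    relative to [t]. No measurability of the suprema is used, since the integral
    of a nonnegative function is the supremum of the integrals of the simple
    functions below it. *)

(** * Orthonormal expansions in a Hilbert space *)

Section InnerProduct.
Context {R : realType} {V : hilbertType R}.
Implicit Types (x y z : V) (e : nat -> V) (c : nat -> R).

Lemma innerC x y : inner x y = inner y x.
Proof. by rewrite (hermC (@inner R V)) expr0 mul1r. Qed.

Lemma normDsq x y : inner x y = 0 -> `|x + y| ^+ 2 = `|x| ^+ 2 + `|y| ^+ 2.
Proof. by move=> xy0; rewrite -!inner_normE hnormDd. Qed.

Lemma normBsq x y :
  `|x - y| ^+ 2 = `|x| ^+ 2 - inner x y *+ 2 + `|y| ^+ 2.
Proof.
by rewrite -!inner_normE linearBl !linearBr /= (innerC y x) mulr2n; ring.
Qed.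

Lemma cauchy_schwarz x y : `|inner x y| <= `|x| * `|y|.
Proof.
have [->|y0] := eqVneq y 0; first by rewrite linear0r !normr0 mulr0.
have ny : 0 < `|y| ^+ 2 by rewrite exprn_gt0// normr_gt0.
(* The subtracted vector is the orthogonal projection of [x] onto the line of [y]; expanding the
   square gives the squared inequality divided by the squared norm of [y]. *)
have := sqr_ge0 `|x - (inner x y / `|y| ^+ 2) *: y|.
rewrite normBsq linearZr_LR /= normrZ exprMn real_normK ?num_real//.
set n2 := `|y| ^+ 2 in ny *; set q := inner x y => H.
have {H} : q ^+ 2 <= `|x| ^+ 2 * n2.
  rewrite -ler_pdivrMr// -subr_ge0; move: H; congr (_ <= _).
  by field; rewrite lt0r_neq0.
rewrite -exprMn -[q ^+ 2]real_normK ?num_real//.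
by rewrite ler_pXn2r// nnegrE ?mulr_ge0.
Qed.

Lemma continuous_innerl y : continuous (fun x => inner x y).
Proof.
move=> x; apply/cvgrPdist_le => e e0; near=> z.
rewrite -linearBl (le_trans (cauchy_schwarz _ _))//.
(* Adding 1 keeps the Lipschitz constant positive when [y] is 0. *)
have y1 : 0 < `|y| + 1 by rewrite ltr_wpDl.
apply: (@le_trans _ _ (`|x - z| * (`|y| + 1))); first by rewrite ler_wpM2l// lerDl.
rewrite -ler_pdivlMr//; near: z.
by apply: cvgr_dist_le; [exact: cvg_id|rewrite divr_gt0].
Unshelve. all: by end_near. Qed.

Lemma inner_cvgl (s : V^nat) x y :
  s @ \oo --> x -> (fun n => inner (s n) y) @ \oo --> inner x y.
Proof. by move=> sx; exact: (continuous_cvg _ (@continuous_innerl y x) sx). Qed.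

Lemma inner_suml (I : Type) (r : seq I) (p : pred I) (f : I -> V) y :
  inner (\sum_(i <- r | p i) f i) y = \sum_(i <- r | p i) inner (f i) y.
Proof. by rewrite linear_sumlz. Qed.

Lemma inner_sum_orthonormal e c (r : seq nat) n : orthonormal_seq e -> uniq r ->
  inner (\sum_(k <- r) c k *: e k) (e n) = if n \in r then c n else 0.
Proof.
move=> oe ur; rewrite inner_suml.
under eq_bigr do rewrite linearZl_LR /= oe.
case: ifPn => [nr|nr].
  rewrite (bigD1_seq n)//= eqxx mulr1 big1 ?addr0// => k /negbTE ->.
  by rewrite mulr0.
rewrite big_seq big1// => k kr; case: eqP => [kn|]; last by rewrite mulr0.
by rewrite kn (negbTE nr) in kr.
Qed.

Lemma normsq_sum_orthonormal e c (r : seq nat) : orthonormal_seq e -> uniq r ->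
  `|\sum_(k <- r) c k *: e k| ^+ 2 = \sum_(k <- r) c k ^+ 2.
Proof.
move=> oe ur; rewrite -inner_normE linear_sumr/= big_seq [RHS]big_seq.
apply: eq_bigr => k kr.
by rewrite linearZr_LR /= inner_sum_orthonormal// kr expr2.
Qed.

Lemma inner_partial_sum e c N n : orthonormal_seq e ->
  inner (series (fun k => c k *: e k) N) (e n) = if (n < N)%N then c n else 0.
Proof.
by move=> oe; rewrite seriesEnat inner_sum_orthonormal ?iota_uniq// mem_index_iota.
Qed.

(** Bessel's identity; nonnegativity of its left side is Bessel's inequality. *)
Lemma normsq_residual e x N : orthonormal_seq e ->
  `|x - series (fun k => inner x (e k) *: e k) N| ^+ 2 =
  `|x| ^+ 2 - \sum_(0 <= k < N) inner x (e k) ^+ 2.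
Proof.
move=> oe; rewrite normBsq seriesEnat normsq_sum_orthonormal ?iota_uniq//.
rewrite linear_sumr/=; under eq_bigr do rewrite linearZr_LR /= -expr2.
by rewrite mulr2n; ring.
Qed.

(** Bessel's inequality makes the squared coefficients summable. By Pythagoras, a block of them sums
    to the squared norm of the matching block of vectors, so the Cauchy criterion transfers with
    tolerance [eps ^+ 2]. *)
Lemma cvg_orthonormal_expansion e x : orthonormal_seq e ->
  cvgn (series (fun k => inner x (e k) *: e k)).
Proof.
move=> oe; apply/cauchy_cvgP/cauchy_seriesP => eps eps0.
have : cvgn (series (fun k => inner x (e k) ^+ 2)).
  apply: nondecreasing_is_cvgn.
    by apply: nondecreasing_series => k *; exact: sqr_ge0.
  exists (`|x| ^+ 2) => _ [N _ <-].
  by rewrite -subr_ge0 /= seriesEnat -normsq_residual// sqr_ge0.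
move=> /cauchy_cvgP/cauchy_seriesP/(_ (eps ^+ 2)); rewrite exprn_gt0//.
move=> /(_ isT); apply: filterS => -[m n] /=.
rewrite ger0_norm ?sumr_ge0// => [|k _]; last exact: sqr_ge0.
rewrite -(normsq_sum_orthonormal _ oe) ?iota_uniq//.
by rewrite ltr_pXn2r// nnegrE// ltW.
Qed.

Lemma inner_cvg_orthonormal_series e c z n : orthonormal_seq e ->
  series (fun k => c k *: e k) @ \oo --> z -> inner z (e n) = c n.
Proof.
move=> oe /(inner_cvgl (y := e n)) /cvg_lim <- //; apply: cvg_lim => //.
apply: cvg_near_cst; near=> N; rewrite inner_partial_sum// ifT//.
by near: N; exact: nbhs_infty_gt.
Unshelve. all: by end_near. Qed.

Lemma series_lspan e c N : lspan (range e) (series (fun k => c k *: e k) N).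
Proof.
exists N, (fun i => c i), (fun i => e i); split; first by move=> i; exists i.
by rewrite seriesEord.
Qed.

Lemma cvg_series_closure_lspan e c z :
  series (fun k => c k *: e k) @ \oo --> z -> closure (lspan (range e)) z.
Proof.
move=> cz; apply: (closed_cvg _ (@closed_closure _ _) _ _ cz).
by near=> N; apply: subset_closure; exact: series_lspan.
Unshelve. all: by end_near. Qed.

End InnerProduct.

(** * The pseudo-inverse as a projection, and pointwise error bounds *)

Section Reconstruction.
Context {R : realType} {X Y : hilbertType R} (A : {linear X -> Y}).
Context (sigma : nat -> R) (u : nat -> X) (v : nat -> Y).
Implicit Types (g : nat -> R) (x : X) (y : Y).

Definition range_projection x : X := pseudo_inverse A (A x).

Definition truncated_inverse (N n : nat) : R :=
  if (n < N)%N then (sigma n)^-1 else 0.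

Lemma inner_svd x n : singular_value_expansion A sigma u v ->
  inner (A x) (v n) = sigma n * inner x (u n).
Proof.
by move=> [_ _ [ov _] Asvd]; exact: inner_cvg_orthonormal_series (Asvd x).
Qed.

Lemma orthocompl_null_series (c : nat -> R) z :
  singular_value_expansion A sigma u v ->
  series (fun n => c n *: u n) @ \oo --> z -> orthocompl (null_space A) z.
Proof. by move=> [_ [_ ->] _ _] /cvg_series_closure_lspan. Qed.

(** The limit of the expansion of [x] along [u] has the property selected by [pseudo_inverse], so
    [xget] does not fall back to its default. The selected point equals this limit: their difference
    lies both in the null space and in its orthogonal complement. *)
Lemma pseudo_inverse_projection x : singular_value_expansion A sigma u v ->
  [/\ orthocompl (null_space A) (range_projection x),
      A (x - range_projection x) = 0 &
      series (fun n => inner x (u n) *: u n) @ \oo --> range_projection x].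
Proof.
move=> svd; have [_ [ou _] _ Asvd] := svd.
have /cvg_ex[z xz] := cvg_orthonormal_expansion (x := x) ou.
have zN := orthocompl_null_series svd xz.
(* [x - z] is orthogonal to every [u n], so all terms of its singular value expansion vanish. *)
have Axz : A (x - z) = 0.
  have /cvg_lim <- // := Asvd (x - z); apply: cvg_lim => //.
  apply: cvg_near_cst; near=> N; rewrite seriesEnat/= big1// => n _.
  rewrite linearBl /= (inner_cvg_orthonormal_series _ ou xz).
  by rewrite subrr mulr0 scale0r.
have [pN pR] : orthocompl (null_space A) (range_projection x) /\
    orthocompl (range A) (A x - A (range_projection x)).
  apply: (@xgetPex _ 0 [set w | orthocompl (null_space A) w /\
    orthocompl (range A) (A x - A w)]).
  by exists z; split=> // _ [w _ <-]; rewrite -linearB Axz linear0l.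
(* This vector lies in the range of [A] and is orthogonal to that range, hence to itself. *)
have Axp : A (x - range_projection x) = 0.
  apply/eqP; rewrite -normr_eq0 -sqrf_eq0 -inner_normE {1}linearB.
  by apply/eqP/pR; exists (x - range_projection x).
suff <- : z = range_projection x by split.
apply/eqP; rewrite -subr_eq0 -normr_eq0 -sqrf_eq0 -inner_normE.
have dN : null_space A (z - range_projection x).
  rewrite /null_space/= -[z](subKr x) addrAC linearB Axp Axz subrr//.
by rewrite {1}linearBl /= zN// pN// subrr.
Unshelve. all: by end_near. Qed.

Definition residual x : R := `|x - range_projection x| ^+ 2.

(** By Bessel's identity, the squared distance from [x] to its truncated expansion; in this form
    measurability and the bound by the squared norm of [x] are immediate. *)
Definition truncated_residual (N : nat) x : R :=
  `|x| ^+ 2 - \sum_(0 <= n < N) inner x (u n) ^+ 2.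

Lemma truncated_residualE N x : orthonormal_seq u -> truncated_residual N x =
  `|x - series (fun n => inner x (u n) *: u n) N| ^+ 2.
Proof. by move=> ou; rewrite normsq_residual. Qed.

Lemma truncated_residual_ge0 N x : orthonormal_seq u -> 0 <= truncated_residual N x.
Proof. by move=> ou; rewrite truncated_residualE// sqr_ge0. Qed.

Lemma truncated_residual_le N x : truncated_residual N x <= `|x| ^+ 2.
Proof. by rewrite lerBlDr lerDl sumr_ge0// => n _; exact: sqr_ge0. Qed.

Lemma truncated_residual_cvg x : singular_value_expansion A sigma u v ->
  truncated_residual ^~ x @ \oo --> residual x.
Proof.
move=> svd; have [_ [ou _] _ _] := svd.
have [_ _ xp] := pseudo_inverse_projection x svd.
under eq_fun do rewrite truncated_residualE//.
under eq_fun do rewrite expr2; rewrite /residual expr2.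
have xs : (fun N => `|x - series (fun n => inner x (u n) *: u n) N|) @ \oo -->
    `|x - range_projection x|.
  by apply: cvg_norm; apply: cvgB => //; exact: cvg_cst.
exact: (cvgM xs xs).
Qed.

Local Open Scope ereal_scope.

Lemma recon_error_ge0 g y (x : X) : 0 <= recon_error g u v y x.
Proof. by rewrite /recon_error; case: ifP => // _; rewrite lee_fin. Qed.

(* Pythagoras, then AM-GM [2 t e <= t ^ 2 + e ^ 2]; stated without squaring the
   error to the projection so that suprema and integrals of it stay linear. *)
Lemma recon_error_projection g y x (t : R) : (0 < t)%R ->
  singular_value_expansion A sigma u v ->
  (2 * t)%:E * recon_error g u v y (range_projection x) + (residual x)%:E <=
  (t ^+ 2)%:E + recon_error g u v y x ^+ 2.
Proof.
move=> t0 svd; rewrite /recon_error; case: ifPn => [/asboolP gy|_]; last first.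
  by rewrite [X in _ <= _ + X]expe2 mulyy addey ?leey.
have [pN xpN _] := pseudo_inverse_projection x svd.
have LN := orthocompl_null_series svd gy.
set L := limn _ in LN *.
rewrite -EFin_expe -!EFinM -!EFinD lee_fin.
have -> : (L - x = (L - range_projection x) - (x - range_projection x))%R.
  by rewrite opprB addrA subrK.
(* [L] and the projection lie in the orthogonal complement of the null space, while
   [x - range_projection x] is in the null space: the cross term is 0. *)
rewrite normBsq linearBl /= LN// pN// subrr mul0rn subr0 /residual addrA lerD2r.
rewrite -subr_ge0; apply: le_trans (sqr_ge0 (t - `|L - range_projection x|)%R) _.
by rewrite le_eqVlt; apply/orP; left; apply/eqP; ring.
Qed.

Lemma recon_error_truncated N x (eps : Y) (delta : R) : (`|eps| <= delta)%R ->
  singular_value_expansion A sigma u v ->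
  recon_error (truncated_inverse N) u v (A x + eps)%R x ^+ 2 <=
  (truncated_residual N x + delta ^+ 2 * \sum_(0 <= n < N) (sigma n) ^- 2)%:E.
Proof.
move=> epsd svd; have [sigma0 [ou _] [ov _] _] := svd.
(* The competitor sends the exact data [A x] to [p], as [(sigma n)^-1] cancels [sigma n], and sends
   the noise to [w]. *)
pose w := (\sum_(n <- index_iota 0 N) ((sigma n)^-1 * inner eps (v n)) *: u n)%R.
pose p := series (fun n => inner x (u n) *: u n)%R N.
have cvgp : recon_series (truncated_inverse N) u v (A x + eps)%R @ \oo --> (p + w)%R.
  apply: cvg_near_cst; near=> M.
  have NM : (N <= M)%N by near: M; exact: nbhs_infty_ge.
  rewrite /recon_series /p !seriesEnat/= (big_cat_nat (leq0n N) NM)//=.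
  rewrite [X in (_ + X)%R]big_nat_cond [X in (_ + X)%R]big1 ?addr0; last first.
    move=> n /andP[/andP[Nn _] _].
    by rewrite /truncated_inverse ltnNge Nn/= mul0r scale0r.
  rewrite -big_split/=; apply: eq_big_nat => n /andP[_ nN].
  rewrite /truncated_inverse nN linearDl /= inner_svd// -scalerDl mulrDr mulrA.
  by rewrite mulVf ?mul1r// gt_eqF.
rewrite /recon_error ifT; last by apply/asboolP/cvg_ex; exists (p + w)%R.
rewrite (cvg_lim _ cvgp)// -EFin_expe lee_fin.
have wp : inner w (x - p)%R = 0%R.
  rewrite inner_suml big_nat_cond big1// => n /andP[/andP[_ nN] _].
  rewrite linearZl_LR /= linearBr /= [inner (u n) p]innerC inner_partial_sum//.
  by rewrite nN innerC subrr mulr0.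
have -> : (p + w - x = w - (x - p))%R by rewrite opprB addrA (addrC w).
rewrite normBsq wp mul0rn subr0 addrC truncated_residualE// lerD2l.
rewrite normsq_sum_orthonormal ?iota_uniq// mulr_sumr.
apply: ler_sum => n _; rewrite exprMn exprVn mulrC ler_wpM2r//.
  by rewrite invr_ge0 sqr_ge0.
rewrite -[leLHS]real_normK ?num_real// lerXn2r ?nnegrE//.
  exact: le_trans epsd.
(* Each noise coefficient is bounded separately by [delta], since [v n] is a unit vector. *)
apply: le_trans epsd; apply: le_trans (cauchy_schwarz _ _) _.
suff -> : `|v n|%R = 1%R by rewrite mulr1.
by apply/eqP; rewrite -sqrp_eq1// -inner_normE ov eqxx.
Unshelve. all: by end_near. Qed.

End Reconstruction.

(** Nonemptiness of [D] matters: the supremum of the empty set is [-oo]. *)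
Lemma ereal_sup_image_ge0 (R : realType) (T : Type) (D : set T) (f : T -> \bar R) :
  D !=set0 -> (forall x, 0 <= f x)%E -> (0 <= ereal_sup (f @` D))%E.
Proof.
by move=> [x Dx] f0; apply: le_trans (f0 x) _; apply: ereal_sup_ubound; exists x.
Qed.

(** * Integrals of nonnegative functions that may fail to be measurable *)

Section LowerIntegral.
Local Open Scope ereal_scope.
Context d {T : measurableType d} {R : realType}.
Context (P : probability T R).
Import HBNNSimple.

(** A simple function below [f] is also below [g], so the supremum for [g] runs over a larger
    set. *)
Lemma ge0_le_lower_integral (f g : T -> \bar R) : (forall x, 0 <= f x) ->
  (forall x, f x <= g x) -> \int[P]_x f x <= \int[P]_x g x.
Proof.
move=> f0 fg; have g0 x : 0 <= g x by exact: le_trans (fg x).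
rewrite !ge0_integralTE//; apply: ereal_sup_le => _ [h hf <-].
by exists h => // x; exact: le_trans (hf x) (fg x).
Qed.

(** Additivity may fail for [f] and [g], so it is applied to measurable functions only: each simple
    [h] below [f] yields a measurable minorant [l] of [g] with [c * h + a <= k + l]. As [a] has a
    finite integral, it can be moved across before [h] varies. *)
Lemma ge0_affine_le_lower_integral (f g : T -> \bar R) (a : T -> R) (c k : R) :
  (forall x, 0 <= f x) -> (forall x, 0 <= g x) ->
  (forall x, 0 <= a x)%R -> measurable_fun setT a ->
  \int[P]_x (a x)%:E \is a fin_num -> (0 < c)%R -> (0 <= k)%R ->
  (forall x, c%:E * f x + (a x)%:E <= k%:E + g x) ->
  c%:E * \int[P]_x f x + \int[P]_x (a x)%:E <= k%:E + \int[P]_x g x.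
Proof.
move=> f0 g0 a0 ma afin c0 k0 fg.
rewrite -leeBrDr// -lee_pdivlMl// ge0_integralTE//.
apply: ge_ereal_sup => _ [h hf <-].
rewrite lee_pdivlMl// leeBrDr// -integralT_nnsfun -ge0_integralZl_EFin//; last 3 first.
- by move=> x _; rewrite lee_fin fun_ge0.
- exact/measurable_EFinP.
- exact: ltW.
rewrite -ge0_integralD//; last 4 first.
- by move=> x _; rewrite -EFinM lee_fin mulr_ge0// ?ltW// fun_ge0.
- by apply/measurable_EFinP => /=; exact: measurable_funM.
- by move=> x _; rewrite lee_fin.
- exact/measurable_EFinP.
(* Taking the positive part makes the minorant nonnegative; it stays below [g] because [g] is
   nonnegative. *)
pose l x := Num.max 0%R (c * h x + a x - k)%R.
have ml : measurable_fun setT l.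
  by apply: measurable_maxr => //; apply: measurable_funB => //;
     apply: measurable_funD => //; exact: measurable_funM.
have l0 x : (0 <= l x)%R by rewrite /l le_max lexx.
have lg x : (l x)%:E <= g x.
  rewrite /l /Num.max; case: ifPn => // _.
  rewrite EFinB leeBlDl// EFinD EFinM; apply: le_trans (fg x).
  by rewrite leeD2r// lee_pmul2l// lte_fin.
apply: (@le_trans _ _ (\int[P]_x (k%:E + (l x)%:E))).
  apply: ge0_le_lower_integral => x.
    by rewrite -EFinM -EFinD lee_fin addr_ge0// mulr_ge0// ltW.
  by rewrite -EFinM -!EFinD lee_fin -lerBlDl /l le_max lexx orbT.
rewrite ge0_integralD//; last 2 first.
- by move=> x _; rewrite lee_fin.
- exact/measurable_EFinP.
rewrite integral_cst// [X in k%:E * X]probability_setT mule1 leeD2l//.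
by apply: ge0_le_lower_integral => // x; rewrite lee_fin.
Qed.

End LowerIntegral.

(** * Borel measurability and expected errors *)

Lemma continuous_borel_measurable (R : realType) (X : ptopologicalType)
    (f : X -> R) :
  continuous f -> measurable_fun [set: g_sigma_algebraType (@open X)] f.
Proof.
move=> cf; apply: (measurability _ (RGenOpens.measurableE R)).
move=> _ [_ [x [y ->]] <-]; rewrite setTI; apply: sub_sigma_algebra.
by apply: open_comp; [move=> ? _; exact: cf | exact: interval_open].
Qed.

Section AdversarialRisk.
Local Open Scope ereal_scope.
Context {R : realType} {X Y : hilbertType R} (A : {linear X -> Y}).
Context (sigma : nat -> R) (u : nat -> X) (v : nat -> Y).
Context (P : probability (g_sigma_algebraType (@open X)) R).
Implicit Types (g : nat -> R) (delta t : R).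

Lemma measurable_truncated_residual N :
  measurable_fun [set: g_sigma_algebraType (@open X)] (truncated_residual u N).
Proof.
apply: measurable_funB.
  apply: measurable_funX; apply: continuous_borel_measurable.
  exact: norm_continuous.
apply: measurable_sum => n; apply: measurable_funX.
by apply: continuous_borel_measurable; exact: continuous_innerl.
Qed.

(** [range_projection] is defined by a choice, so measurability is read off from the pointwise limit
    of the truncated residuals. *)
Lemma measurable_residual : singular_value_expansion A sigma u v ->
  measurable_fun [set: g_sigma_algebraType (@open X)] (residual A).
Proof.
move=> svd; apply: (measurable_fun_cvg measurable_truncated_residual) => x _.
exact: truncated_residual_cvg svd.
Qed.

Lemma integral_truncated_residual_cvg : singular_value_expansion A sigma u v ->
  \int[P]_x ((`|x : X| ^+ 2)%:E) < +oo ->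
  \int[P]_x (truncated_residual u N x)%:E @[N --> \oo] -->
  \int[P]_x (residual A x)%:E.
Proof.
move=> svd m2; have [_ [ou _] _ _] := svd.
have mn : measurable_fun [set: g_sigma_algebraType (@open X)]
    (fun x : X => `|x| ^+ 2)%R.
  apply: measurable_funX; apply: continuous_borel_measurable.
  exact: norm_continuous.
apply: (@dominated_cvg _ _ _ P _ measurableT _ _ (fun x : X => (`|x| ^+ 2)%:E)) => //.
- by move=> N; apply/measurable_EFinP; exact: measurable_truncated_residual.
- move=> x _; apply: cvg_EFin; first exact: nearW.
  exact: truncated_residual_cvg svd.
- apply/integrableP; split; first exact/measurable_EFinP.
  apply: le_lt_trans m2; apply: ge0_le_lower_integral => x; first exact: abse_ge0.
  by rewrite gee0_abs// lee_fin sqr_ge0.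
move=> N x _; rewrite gee0_abs ?lee_fin; last exact: truncated_residual_ge0.
exact: truncated_residual_le.
Qed.

Lemma integral_residual_fin_num : singular_value_expansion A sigma u v ->
  \int[P]_x ((`|x : X| ^+ 2)%:E) < +oo ->
  \int[P]_x (residual A x)%:E \is a fin_num.
Proof.
move=> svd m2; have [_ [ou _] _ _] := svd.
rewrite ge0_fin_numE; last by apply: integral_ge0 => x _; rewrite lee_fin sqr_ge0.
apply: le_lt_trans m2; apply: ge0_le_lower_integral => x.
  by rewrite lee_fin sqr_ge0.
rewrite lee_fin; apply: (ler_cvg_to (truncated_residual_cvg svd) (cvg_cst _)).
by apply: nearW => N; exact: truncated_residual_le.
Qed.

Lemma adv2_objective_truncated_le delta N : (0 < delta)%R ->
  singular_value_expansion A sigma u v ->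
  adv2_objective P A u v delta (truncated_inverse sigma N) <=
  \int[P]_x (truncated_residual u N x)%:E +
  (delta ^+ 2 * \sum_(0 <= n < N) (sigma n) ^- 2)%:E.
Proof.
move=> d0 svd; have [_ [ou _] _ _] := svd.
set C := (delta ^+ 2 * _)%R.
have C0 : (0 <= C)%R.
  by rewrite mulr_ge0 ?sqr_ge0// sumr_ge0// => n _; rewrite invr_ge0 sqr_ge0.
(* Since [P] has mass 1, the constant becomes an integral and merges with the other one. *)
rewrite -[C%:E]mule1 -[X in C%:E * X](@probability_setT _ _ _ P) -integral_cst//.
rewrite -ge0_integralD//; last 2 first.
- by move=> x _; rewrite lee_fin; exact: truncated_residual_ge0.
- by apply/measurable_EFinP; exact: measurable_truncated_residual.
apply: ge0_le_lower_integral => x.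
  apply: ereal_sup_image_ge0 => [|eps]; last exact/expe_ge0/recon_error_ge0.
  by exists 0%R; rewrite /= normr0 ltW.
by apply: ge_ereal_sup => _ [eps /= epsd <-]; exact: recon_error_truncated.
Qed.

Lemma projection_risk_le_adv2_objective g delta t : (0 < delta)%R -> (0 < t)%R ->
  singular_value_expansion A sigma u v ->
  \int[P]_x ((`|x : X| ^+ 2)%:E) < +oo ->
  (2 * t)%:E * (\int[P]_x ereal_sup
     [set recon_error g u v (A x + eps)%R (range_projection A x) |
        eps in [set eps : Y | (`|eps| < delta)%R]]) +
  \int[P]_x (residual A x)%:E <=
  (t ^+ 2)%:E + adv2_objective P A u v delta g.
Proof.
move=> d0 t0 svd m2; apply: ge0_affine_le_lower_integral.
- move=> x; apply: ereal_sup_image_ge0 => [|eps]; last exact: recon_error_ge0.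
  by exists 0%R; rewrite /= normr0.
- move=> x; apply: ereal_sup_image_ge0 => [|eps]; last exact/expe_ge0/recon_error_ge0.
  by exists 0%R; rewrite /= normr0 ltW.
- by move=> x; exact: sqr_ge0.
- exact: measurable_residual svd.
- exact: integral_residual_fin_num svd m2.
- by rewrite mulr_gt0.
- exact: sqr_ge0.
move=> x; rewrite -leeBrDr// -lee_pdivlMl ?mulr_gt0//.
apply: ge_ereal_sup => _ [eps epsd <-].
rewrite lee_pdivlMl ?mulr_gt0// leeBrDr//.
apply: le_trans (recon_error_projection g _ x t0 svd) _.
(* The risk ranges over the open noise ball and the objective over the closed one. *)
by rewrite leeD2l//; apply: ereal_sup_ubound; exists eps => //=; exact: ltW.
Qed.

End AdversarialRisk.

(** * Choice of parameters and passage to the limit *)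

Theorem lemma10 (R : realType) (X Y : hilbertType R) (A : {linear X -> Y})
    (A_compact : compact_operator A)
    (A_range : infinite_dimensional (range A))
    (sigma : nat -> R) (u : nat -> X) (v : nat -> Y)
    (A_svd : singular_value_expansion A sigma u v)
    (P : probability (g_sigma_algebraType (@open X)) R)
    (P_moment2 : (\int[P]_x ((`|x : X| ^+ 2)%:E) < +oo)%E)
    (g_adv2 : R -> nat -> R)
    (g_adv2_min : forall delta : R, 0 < delta ->
       adv2_minimizer P A u v delta (g_adv2 delta)) :
  (\int[P]_x ereal_sup
     [set recon_error (g_adv2 delta) u v (A x + eps)%R (pseudo_inverse A (A x)) |
        eps in [set eps : Y | (`|eps| < delta)%R]])%E
    @[delta --> 0^'+] --> 0%E.
Proof.
set risk := (F in F @ _ --> _).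
have risk_ge0 delta : 0 < delta -> (0 <= risk delta)%E.
  move=> d0; apply: integral_ge0 => x _.
  apply: ereal_sup_image_ge0 => [|eps]; last exact: recon_error_ge0.
  by exists 0; rewrite /= normr0.
(* The risk is extended-real: the bound with [e = 1] makes it eventually finite, and arbitrary [e]
   then gives convergence of the real values. *)
suff risk_le (e : R) : 0 < e -> \forall delta \near 0^'+, (risk delta <= e%:E)%E.
  apply/fine_cvgP; split.
    near=> delta; rewrite ge0_fin_numE; last exact: risk_ge0.
    by apply: (@le_lt_trans _ _ 1%:E); [near: delta; exact: risk_le|exact: ltry].
  apply/cvgrPdist_le => e e0; near=> delta.
  have d0 : (0 <= risk delta)%E by exact: risk_ge0.
  have de : (risk delta <= e%:E)%E by near: delta; exact: risk_le.
  rewrite sub0r normrN ger0_norm ?fine_ge0// -lee_fin fineK//.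
  by rewrite ge0_fin_numE// (le_lt_trans de)// ltry.
move=> e0; set a := (\int[P]_x (residual A x)%:E)%E.
have afin : a \is a fin_num by exact: integral_residual_fin_num A_svd P_moment2.
have e22 : 0 < e ^+ 2 / 2 by rewrite divr_gt0// exprn_gt0.
(* Truncation and noise may each cost [e ^+ 2 / 2]; [N] is fixed before [delta] because the noise
   constant [C] depends on it. *)
have [N aN] : exists N,
    (\int[P]_x (truncated_residual u N x)%:E <= a + (e ^+ 2 / 2)%:E)%E.
  have := integral_truncated_residual_cvg A_svd P_moment2; rewrite -/a -(fineK afin).
  move=> /fine_cvgP[fN /cvgrPdist_le/(_ _ e22) aN].
  have [N _ /(_ N (leqnn _)) [/= NN]] := filterI fN aN.
  rewrite distrC => /ler_normlP[_ H]; exists N.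
  by rewrite -(fineK NN) -EFinD lee_fin -lerBlDl.
set C := \sum_(0 <= n < N) (sigma n) ^- 2.
have C0 : 0 <= C by apply: sumr_ge0 => n _; rewrite invr_ge0 sqr_ge0.
near=> delta.
have d0 : 0 < delta by [].
have d1 : delta <= 1 by near: delta; exact: nbhs_right_le.
(* [delta <= 1] makes the bound linear in [delta]; [C + 1] avoids dividing by 0 when [C] is 0. *)
have dC : delta ^+ 2 * C <= e ^+ 2 / 2.
  apply: (@le_trans _ _ (delta * (C + 1))).
    by rewrite expr2 ler_pM ?mulr_ge0 ?lerDl ?ler_piMl// ltW.
  rewrite -ler_pdivlMr ?ltr_wpDl//; near: delta.
  by apply: nbhs_right_le; rewrite divr_gt0// ltr_wpDl.
(* With the AM-GM parameter [t = e], the right side totals [e ^+ 2 + a + e ^+ 2 / 2 + e ^+ 2 / 2],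
   that is [2 * e * e + a]; cancelling [a] and [2 * e] leaves the bound [e]. *)
have := projection_risk_le_adv2_objective (g_adv2 delta) d0 e0 A_svd P_moment2.
move=> /le_trans/(_ (leeD2l _ (g_adv2_min _ d0 (truncated_inverse sigma N)))).
move=> /le_trans/(_ (leeD2l _ (adv2_objective_truncated_le P N d0 A_svd))).
rewrite -/C -/(risk delta) -/a => H.
rewrite -(@lee_pmul2l _ (2 * e)%:E) ?lte_fin ?mulr_gt0//.
rewrite -(leeD2rE _ _ afin); apply: le_trans H _.
apply: (@le_trans _ _ ((e ^+ 2)%:E + ((a + (e ^+ 2 / 2)%:E) + (e ^+ 2 / 2)%:E))%E).
  by rewrite leeD2l// leeD.
rewrite -(fineK afin) -!EFinD lee_fin.
by rewrite le_eqVlt; apply/orP; left; apply/eqP; field.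
Unshelve. all: by end_near. Qed.
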